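(* (a) For every integer $k\ge 2$, the map $T\mapsto E(T)$ (defined in the context) is a one-to-one correspondence between rooted binary trees with $k-2$ nodes and normalized half-plane polygons $e_0,e_1,\dots,e_k$. (b) Every fundamental polygon with at least $4$ vertices is determined, up to a global linear conjugation, by two rooted binary trees and an integer: for every fundamental polygon $P$ with $n\ge4$ vertices there exist rooted binary trees $T_1,T_2$, an integer $m$ and an invertible linear map $g$ of $\mathbb{R}^2$ such that the image under $g$ of the vertex list of $P$ is, up to cyclic relabelling, the list $P(T_1,T_2,m)$.
   Context: Fundamental polygon: a star shaped polygon given by vertices $e_0,\dots,e_{n-1}$ with integer coordinates, listed anti-clockwise going once around the origin, such that $\det[e_i,e_{i+1}]=1$ for all $i$ modulo $n$ (equivalently each triangle $0,e_i,e_{i+1}$ has area $\frac12$). Normalized half-plane polygon (with $k\ge 2$): a list $e_0,e_1,\dots,e_k$ of distinct nonzero integer vectors with nonnegative $y$-coordinate, arranged in anti-clockwise order, with $e_0=(1,0)^t$, $e_1=(0,1)^t$, $e_k=(-1,0)^t$, and $\det[e_i,e_{i+1}]=1$ for $0\le i<k$. Rooted binary tree: a finite, possibly empty, rooted tree in which each node has at most one left child and at most one right child (left and right being distinguished). For a nonempty tree $T$ let $T_L$ and $T_R$ be the (possibly empty) subtrees rooted at the left and right child of the root. For integer vectors $u,v$ define the finite list $W(T;u,v)$ recursively: $W(T;u,v)$ is the empty list if $T$ is empty, and otherwise it is the concatenation of $W(T_R;u,u+v)$, the single vector $u+v$, and $W(T_L;u+v,v)$. (Each node of $T$ corresponds to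 inserting the sum of two adjacent vectors.) Let $E(T)$ be the list $$(1,0)^t,\ (0,1)^t,\ W\big(T;(0,1)^t,(-1,0)^t\big),\ (-1,0)^t .$$ Given rooted binary trees $T_1,T_2$ and $m\in\mathbb{Z}$, write $E(T_1)=(e_0,\dots,e_{k})$, $E(T_2)=(e_0',\dots,e'_{l})$ and $S=\begin{pmatrix}1&m\\0&1\end{pmatrix}$. Let $P(T_1,T_2,m)$ be the list $$e_0,\ e_1,\dots,e_{k-1},\ -Se'_0,\ -Se'_1,\dots,-Se'_{l-1}.$$ *)

(* Defs.v *)
From HB Require Import structures.
From mathcomp Require Import all_boot all_order all_algebra.
From mathcomp Require Import boolp classical_sets functions reals trigo.

Set Implicit Arguments.
Unset Strict Implicit.
Unset Printing Implicit Defensive.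

Import Order.TTheory GRing.Theory Num.Theory.
Local Open Scope ring_scope.

Definition vec (x y : int) : 'cV[int]_2 := \col_(i < 2) [:: x; y]`_i.

Definition det2 (u v : 'cV[int]_2) : int := \det (row_mx u v : 'M[int]_2).

Definition realvec (R : realType) (v : 'cV[int]_2) : 'cV[R]_2 :=
  map_mx (fun z : int => z%:~R) v.

(* Each vector is nonzero, with a polar angle; these angles increase strictly *)
(* along the list and stay within less than a full turn of the first one.     *)
Definition anticlockwise (R : realType) (e : seq 'cV[int]_2) : Prop :=
  exists t : nat -> R,
    [/\ forall i, (i < size e)%N -> exists2 r : R, 0 < r &
          realvec R e`_i = \col_(j < 2) [:: r * cos (t i); r * sin (t i)]`_j,
        forall i j, (i < j < size e)%N -> t i < t j
      & forall i, (i < size e)%N -> t i < t 0%N + 2 * pi].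

(* As all the determinants are positive, including that of the closing edge,   *)
(* consecutive polar angles (the first one being increased by 2 pi on closing  *)
(* up) differ by less than pi. Together with [anticlockwise], this says that   *)
(* the closed polygonal line winds exactly once around the origin and bounds   *)
(* the union of the triangles 0, e_i, e_{i+1}, which only overlap along their  *)
(* sides and form a polygon that is star shaped with respect to the origin.    *)
Definition fundamental_polygon (R : realType) (e : seq 'cV[int]_2) : Prop :=
  [/\ (3 <= size e)%N,
      anticlockwise R e
    & forall i, (i < size e)%N -> det2 e`_i e`_(i.+1 %% size e) = 1].

Definition half_plane_polygon (R : realType) (k : nat) (e : seq 'cV[int]_2) :
    Prop :=
  size e = k.+1 /\
  [/\ uniq e,
      forall v, v \in e -> v != 0 /\ 0 <= v 1 0,
      anticlockwise R e,
      [/\ e`_0 = vec 1 0, e`_1 = vec 0 1 & e`_k = vec (- 1) 0]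
    & forall i, (i < k)%N -> det2 e`_i e`_i.+1 = 1].

Inductive btree : Type :=
| Empty
| Node of btree & btree.  (* left subtree, right subtree *)

Fixpoint nnodes (T : btree) : nat :=
  if T is Node TL TR then (nnodes TL + nnodes TR).+1 else 0%N.

Fixpoint W (T : btree) (u v : 'cV[int]_2) : seq 'cV[int]_2 :=
  if T is Node TL TR then W TR u (u + v) ++ (u + v) :: W TL (u + v) v
  else [::].

Definition E (T : btree) : seq 'cV[int]_2 :=
  [:: vec 1 0, vec 0 1 & W T (vec 0 1) (vec (- 1) 0) ++ [:: vec (- 1) 0]].

Definition shear (m : int) : 'M[int]_2 :=
  row_mx (vec 1 0) (vec m 1) : 'M[int]_(2, 1 + 1).

Definition droplast (s : seq 'cV[int]_2) : seq 'cV[int]_2 :=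
  take (size s).-1 s.

Definition glue_trees (T1 T2 : btree) (m : int) : seq 'cV[int]_2 :=
  droplast (E T1) ++ [seq - (shear m *m v) | v <- droplast (E T2)].

(* Main.v *)
Require Import Defs.
From HB Require Import structures.
From mathcomp Require Import all_boot all_order all_algebra.
From mathcomp Require Import boolp classical_sets functions reals trigo.
From mathcomp Require Import ring lra zify.

Set Implicit Arguments.
Unset Strict Implicit.
Unset Printing Implicit Defensive.

Import Order.TTheory GRing.Theory Num.Theory.
Local Open Scope classical_set_scope.
Local Open Scope ring_scope.

(** Everything is read off from signs of the integer determinants [det2], tied
    together by the Pluecker relation [plucker]; angles only serve to show that
    three successive vertices occur in cyclic order, which in terms of
    determinants is the predicate [ccw] ([ccw_of_angles]).

    Trees and cones.  Let [det2 u v = 1], and let a chain of at least three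
    vectors lead from [u] to [v] inside the cone that they span, consecutive
    determinants being 1.  The chain must contain [u + v]: the coordinates
    [(p, q)] of its members in the basis [(u, v)] are nonnegative, so a cone of
    consecutive members with [p >= q] in the first and [p' < q'] in the second
    has determinant [p q' - p' q >= p], which leaves only [u + v] or the full
    cone itself ([chain_mediant]).  Cutting at [u + v] and recursing produces a
    tree, so the chain is a list [W T u v] ([chain_W]); the tree is unique since
    [u + v] occurs only once in that list ([W_inj]).  For [u = (0, 1)] and
    [v = (-1, 0)] this is the correspondence between trees and half-plane
    polygons; that [E T] is indeed anticlockwise follows by taking the arc
    cosine as polar angle in the upper half-plane ([E_half_plane]).

    Fundamental polygons.  One with at least four vertices has two opposite
    vertices ([opposite_vertices]).  If there were none, no vertex would lie in
    a cone opposite to the cone of an edge ([no_vertex_opposite_cone]).  So for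
    each [i], the vectors [- e_i] and [- e_(i+1)] would lie in the same open
    cone of an edge [e_j, e_(j+1)], hence all of them would, including [- e_j],
    which is absurd.  Once [e_j = - e_0], the basis [(e_0, e_1)] turns
    [e_0, ..., e_j] into a half-plane polygon, and a shear composed with a
    half-turn does the same with [e_j, ..., e_n = e_0]; each half yields a tree
    ([glue_polygon]). *)

(** * Determinants of integer vectors *)

Local Notation ivec := 'cV[int]_2.

Lemma ivecP (u v : ivec) : u 0 0 = v 0 0 -> u 1 0 = v 1 0 -> u = v.
Proof.
move=> h0 h1; apply/matrixP => i j; rewrite (ord1 j).
case: i => [[|[|//]] hi].
- by rewrite (_ : Ordinal hi = 0) //; apply/val_inj.
- by rewrite (_ : Ordinal hi = 1) //; apply/val_inj.
Qed.

Lemma det_mx22 (A : 'M[int]_2) : \det A = A 0 0 * A 1 1 - A 1 0 * A 0 1.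
Proof.
rewrite (expand_det_row _ 0) big_ord_recl big_ord1 /cofactor !det_mx11 !mxE.
have -> : lift 0 0 = 1 :> 'I_2 by apply/val_inj.
have -> : lift 1 0 = 0 :> 'I_2 by apply/val_inj.
by rewrite /= expr0 expr1; ring.
Qed.

Definition frame (u v : ivec) : 'M[int]_2 := row_mx u v : 'M_(2, 1 + 1).

Lemma frameE u v i k : frame u v i k = (if k == 0 then u else v) i 0.
Proof.
by rewrite mxE; case: splitP => j hj; rewrite (ord1 j) -val_eqE /= hj (ord1 j).
Qed.

Lemma det2E (u v : ivec) : det2 u v = u 0 0 * v 1 0 - u 1 0 * v 0 0.
Proof. by rewrite -[det2 u v]/(\det (frame u v)) det_mx22 !frameE. Qed.

Lemma vecE0 x y : vec x y 0 0 = x. Proof. by rewrite mxE. Qed.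
Lemma vecE1 x y : vec x y 1 0 = y. Proof. by rewrite mxE. Qed.

Definition coordE := (vecE0, vecE1).

Lemma det2_vec x y z t : det2 (vec x y) (vec z t) = x * t - y * z.
Proof. by rewrite det2E !coordE. Qed.

Lemma det2_antisym u v : det2 v u = - det2 u v.
Proof. by rewrite !det2E; ring. Qed.

Lemma det2vv u : det2 u u = 0. Proof. by rewrite det2E; ring. Qed.

Lemma det2Nr u v : det2 u (- v) = - det2 u v.
Proof. by rewrite !det2E !mxE; ring. Qed.

Lemma det2Nl u v : det2 (- u) v = - det2 u v.
Proof. by rewrite !det2E !mxE; ring. Qed.

Lemma det2Dr u v w : det2 u (v + w) = det2 u v + det2 u w.
Proof. by rewrite !det2E !mxE; ring. Qed.

Lemma det2Dl u v w : det2 (u + v) w = det2 u w + det2 v w.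
Proof. by rewrite !det2E !mxE; ring. Qed.

(** The three-term relation between the minors of a 2 x 4 matrix. *)
Lemma plucker u v x y :
  det2 u v * det2 x y = det2 x v * det2 u y - det2 u x * det2 y v.
Proof. by rewrite !det2E; ring. Qed.

Lemma basis_expand u v w : det2 u v = 1 -> w = det2 w v *: u + det2 u w *: v.
Proof.
rewrite !det2E => h; apply: ivecP; rewrite !mxE.
- by rewrite -[LHS]mul1r -h; ring.
- by rewrite -[LHS]mul1r -h; ring.
Qed.

Lemma eq_basis u v w w' : det2 u v = 1 ->
  det2 w v = det2 w' v -> det2 u w = det2 u w' -> w = w'.
Proof.
by move=> h h1 h2; rewrite (basis_expand w h) h1 h2 -basis_expand.
Qed.

(** A vector that is part of an integral basis is primitive, so a parallel
    vector of the same kind can only differ from it by a sign. *)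
Lemma parallel_primitive u u' w w' : det2 u u' = 1 -> det2 w w' = 1 ->
  det2 u w = 0 -> w = u \/ w = - u.
Proof.
move=> hu hw h0; have := plucker u u' w w'.
rewrite hu hw h0 mul0r subr0 mulr1 => /esym hc.
have /orP[/eqP h|/eqP h] : (det2 w u' == 1) || (det2 w u' == - 1).
  by rewrite mulrC in hc; have := intUnitRing.unitzPl hc; rewrite qualifE.
- by left; apply: (eq_basis hu); rewrite ?h ?hu // h0 det2vv.
- by right; apply: (eq_basis hu); rewrite ?det2Nl ?det2Nr ?hu ?h0 ?det2vv ?oppr0.
Qed.

Lemma sign_change (g : nat -> int) a b : (a < b)%N -> 0 <= g a -> g b < 0 ->
  exists2 i, (a <= i < b)%N & 0 <= g i /\ g i.+1 < 0.
Proof.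
move=> ab ga; elim: b ab => // b IH; rewrite ltnS leq_eqVlt.
case/predU1P => [<-|ab] gb; first by exists a; rewrite ?leqnn ?ltnSn.
have [g0|g0] := leP 0 (g b); first by exists b; rewrite ?ltnSn ?andbT 1?ltnW.
have [i /andP[ai ib] gi] := IH ab g0; exists i => //.
by rewrite ai ltnW.
Qed.

(** * From trees to chains of vectors *)

Lemma sizeW T u v : size (W T u v) = nnodes T.
Proof.
elim: T u v => //= TL IHL TR IHR u v.
by rewrite size_cat /= IHL IHR addnS addnC.
Qed.

Lemma W_cone T u v w : 0 < det2 u v -> w \in W T u v ->
  0 < det2 u w /\ 0 < det2 w v.
Proof.
elim: T u v => //= TL IHL TR IHR u v huv.
have huc : det2 u (u + v) = det2 u v by rewrite det2Dr det2vv add0r.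
have hcv : det2 (u + v) v = det2 u v by rewrite det2Dl det2vv addr0.
rewrite mem_cat inE => /or3P[/IHR|/eqP->|/IHL]; last 1 first.
- rewrite hcv det2Dl => /(_ huv)[h1 h2]; split=> //.
  by have := det2_antisym v w; lia.
- rewrite huc det2Dr => /(_ huv)[h1 h2]; split=> //.
  by have := det2_antisym u w; lia.
- by rewrite huc hcv.
Qed.

Lemma W_inj T T' u v : 0 < det2 u v -> W T u v = W T' u v -> T = T'.
Proof.
elim: T T' u v => [|TL IHL TR IHR] [|TL' TR'] //= u v huv.
- by case: (W TR' _ _).
- by case: (W TR _ _).
have huc : det2 u (u + v) = det2 u v by rewrite det2Dr det2vv add0r.
have hcv : det2 (u + v) v = det2 u v by rewrite det2Dl det2vv addr0.
have notin t : u + v \notin W t u (u + v).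
  apply/negP => /W_cone; rewrite huc => /(_ huv)[_].
  by rewrite det2vv ltxx.
move=> /eqP; rewrite eqseq_pivot2l // => /andP[/eqP hR /eqP hL].
by rewrite (IHR _ _ _ _ hR) ?(IHL _ _ _ _ hL) ?hcv ?huc.
Qed.

Lemma W_path T u v : det2 u v = 1 ->
  path (fun x y => det2 x y == 1) u (rcons (W T u v) v).
Proof.
elim: T u v => [|TL IHL TR IHR] u v huv /=; first by rewrite huv eqxx.
have huc : det2 u (u + v) = 1 by rewrite det2Dr det2vv add0r.
have hcv : det2 (u + v) v = 1 by rewrite det2Dl det2vv addr0.
by rewrite rcons_cat rcons_cons -cat_rcons cat_path last_rcons IHR ?IHL.
Qed.

Lemma W_closed (P : ivec -> Prop) T u v :
  (forall x y, P x -> P y -> P (x + y)) -> P u -> P v ->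
  forall w, w \in W T u v -> P w.
Proof.
move=> PD; elim: T u v => //= TL IHL TR IHR u v Pu Pv w.
have Pc := PD _ _ Pu Pv.
rewrite mem_cat inE => /or3P[/IHR|/eqP->|/IHL] //; exact.
Qed.

Lemma W_map (A : 'M[int]_2) T u v :
  W T (A *m u) (A *m v) = [seq A *m w | w <- W T u v].
Proof.
elim: T u v => //= TL IHL TR IHR u v.
by rewrite map_cat /= -!mulmxDr IHL IHR.
Qed.

(** * From chains of vectors to trees *)

(** The second condition confines the vectors to an angle less than a half-turn
    and orders them by polar angle. *)
Definition unimodular_chain (f : nat -> ivec) a b :=
  (forall i, (a <= i < b)%N -> det2 (f i) (f i.+1) = 1) /\
  (forall i j, (a <= i < j)%N -> (j <= b)%N -> 0 < det2 (f i) (f j)).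

Lemma sub_chain f a b c d : (a <= c)%N -> (d <= b)%N ->
  unimodular_chain f a b -> unimodular_chain f c d.
Proof.
move=> ac db [h1 h2]; split=> [i hi|i j hi hj]; first by apply: h1; lia.
by apply: h2; lia.
Qed.

(** Starting at [f a], the members of the chain lie on the side of the mediant
    [f a + f b] where the first coordinate dominates; the crossing of the
    mediant happens either at the mediant itself or in the whole cone
    [f a, f b], and the latter would leave no room between [a] and [b]. *)
Lemma chain_mediant f a b : (a.+1 < b)%N -> unimodular_chain f a b ->
  det2 (f a) (f b) = 1 ->
  exists2 m, (a < m < b)%N & f m = f a + f b.
Proof.
move=> ab [f1 fpos] hab.
pose g i := det2 (f i) (f a + f b).
have [|||m /andP[am mb] [gm gm1]] := @sign_change g a b.
- lia.
- by rewrite /g det2Dr det2vv; have := hab; lia.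
- by rewrite /g det2Dr det2vv det2_antisym; have := hab; lia.
have hm := f1 m _; rewrite am mb in hm; have {}hm := hm isT.
(* In the basis [(f a, f b)], [f i] has the coordinates [det2 (f i) (f b)] and
   [det2 (f a) (f i)]. *)
have := plucker (f a) (f b) (f m) (f m.+1); rewrite hab hm.
have Hge i : (a <= i <= b)%N -> 0 <= det2 (f a) (f i) /\ 0 <= det2 (f i) (f b).
  move=> /andP[ai ib]; split.
  - case: (ltngtP a i) ai => // [ai|->] _; last by rewrite det2vv.
    by apply/ltW/fpos; rewrite ?leqnn.
  - case: (ltngtP i b) ib => // [ib|->] _; last by rewrite det2vv.
    by apply/ltW/fpos; rewrite ?ai ?ib.
have [pm qm] := Hge m ltac:(lia).
have [pm1 qm1] := Hge m.+1 ltac:(lia).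
move: gm gm1; rewrite /g !det2Dr (det2_antisym (f a) (f m)).
rewrite (det2_antisym (f a) (f m.+1)) => gm gm1 e.
have [pm0 qm0] : det2 (f m) (f b) = 1 /\
    (det2 (f a) (f m) = 1 \/ det2 (f a) (f m) = 0 /\ det2 (f m.+1) (f b) = 0).
  move: pm qm pm1 qm1 gm gm1 e.
  move: (det2 (f m) (f b)) (det2 (f a) (f m)) (det2 (f m.+1) (f b)).
  move: (det2 (f a) (f m.+1)) => b' x y a'; clear => *.
  have y1 : x = 1 by nia.
  split=> //; nia.
case: qm0 => [h|[h h']].
  have fm : f m = f a + f b.
    by apply: (eq_basis hab); rewrite ?pm0 ?h ?det2Dl ?det2Dr ?det2vv ?hab ?add0r ?addr0.
  exists m => //; rewrite mb andbT ltn_neqAle am andbT.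
  by apply/eqP => am'; move: h; rewrite am' det2vv.
have ma : m = a.
  by apply/eqP/negPn/negP => ma; have := fpos a m ltac:(lia) ltac:(lia); lia.
have mb' : m.+1 = b.
  by apply/eqP/negPn/negP => ma'; have := fpos m.+1 b ltac:(lia) ltac:(lia); lia.
lia.
Qed.

Lemma chain_W f a b : (a < b)%N -> unimodular_chain f a b ->
  det2 (f a) (f b) = 1 ->
  exists T, [seq f i | i <- iota a.+1 (b - a).-1] = W T (f a) (f b).
Proof.
have [n] := ubnP (b - a)%N; elim: n a b => // n IH a b hn ab hf hab.
have [ab1|ab1] := leqP b a.+1.
  by exists Defs.Empty; rewrite (_ : (b - a).-1 = 0%N) //; lia.
have [m /andP[am mb] fm] := chain_mediant ab1 hf hab.
have ham : det2 (f a) (f m) = 1 by rewrite fm det2Dr det2vv add0r.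
have hmb : det2 (f m) (f b) = 1 by rewrite fm det2Dl det2vv addr0.
have [TR hR] := IH a m ltac:(lia) am (sub_chain (leqnn a) (ltnW mb) hf) ham.
have [TL hL] := IH m b ltac:(lia) mb (sub_chain (ltnW am) (leqnn b) hf) hmb.
exists (Node TL TR); rewrite /= -fm -hR -hL -map_cons -map_cat; congr map.
have -> : (b - a).-1 = ((m - a).-1 + (b - m))%N by lia.
rewrite iotaD; have -> : (a.+1 + (m - a).-1 = m)%N by lia.
by rewrite -[in LHS](prednK (n := (b - m)%N)) ?subn_gt0.
Qed.

(** * Opposite vertices *)

(** For three directions met in this order within one turn: if less than a
    half-turn leads from [x] to [z], this also holds for the two steps. *)
Definition ccw x y z := 0 < det2 x z -> 0 < det2 x y /\ 0 < det2 y z.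

(** A fundamental polygon with its vertices numbered periodically, so that any
    vertex can be taken as the first one by a shift of the index. *)
Definition periodic_polygon (n : nat) (f : nat -> ivec) :=
  [/\ forall i, f (n + i)%N = f i,
      forall i, det2 (f i) (f i.+1) = 1
    & forall i j k, (i < j < k)%N -> (k < n + i)%N -> ccw (f i) (f j) (f k)].

Lemma shift_polygon n f s : periodic_polygon n f ->
  periodic_polygon n (fun i => f (s + i)%N).
Proof.
move=> [fn f1 fo]; split=> [i|i|i j k hij hk]; first by rewrite addnCA fn.
  by rewrite addnS f1.
by apply: fo; lia.
Qed.

Lemma ccw_chain f a b :
  (forall i, (a <= i < b)%N -> det2 (f i) (f i.+1) = 1) ->
  (forall i j k, (a <= i)%N -> (i < j < k)%N -> (k <= b)%N ->
     ccw (f i) (f j) (f k)) ->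
  0 < det2 (f a) (f b) -> unimodular_chain f a b.
Proof.
move=> f1 fo fab; split=> // i j /andP[ai ij] jb.
have ib : 0 < det2 (f i) (f b).
  move: ai; rewrite leq_eqVlt => /predU1P[<- //|ai].
  by have [] := fo a i b (leqnn _) ltac:(lia) (leqnn _) fab.
move: jb; rewrite leq_eqVlt => /predU1P[-> //|jb].
by have [] := fo i j b ai ltac:(lia) (leqnn _) ib.
Qed.

(** Suppose that [f j] lies in the open cone spanned by [- f 0] and [- f 1], and
    use [(f 0, f 1)] as basis.  Between [f 1] and [f j] the polygon crosses the
    ray of [- f 0]; this ray not being a vertex, the determinant 1 of the
    crossed edge forces that edge to start at [f 1], whence
    [f 2 = (-1, -s)] with [s > 0].  In the same way the edge that crosses the
    ray of [- f 1] ends at [f n = f 0], and [f (n-1) = (-t, -1)] with [t > 0].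
    As [n > 3], these vertices are distinct and in this order, but their
    determinant is [1 - s t <= 0]. *)
Lemma no_vertex_opposite_first_cone n f j : (4 <= n)%N ->
  (forall i j, f i <> - f j) -> periodic_polygon n f -> (1 < j < n)%N ->
  ~ (0 < det2 (f 1%N) (f j) /\ 0 < det2 (f j) (f 0%N)).
Proof.
move=> n4 no_opp [fn f1 fo] /andP[j1 jn] [hj1 hj0].
have h01 := f1 0%N.
have h02 : det2 (f 0%N) (f 2%N) < 0.
  have [|||i /andP[i1 ij] [gi gi1]] :=
    @sign_change (fun i => det2 (f 0%N) (f i)) 1 j.
  - lia.
  - by rewrite h01.
  - by rewrite det2_antisym; lia.
  have r : 0 < det2 (f 1%N) (f i.+1).
    have [->//|ij'] := eqVneq i.+1 j.
    by have [] := fo 1%N i.+1 j ltac:(lia) ltac:(lia) hj1.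
  have [i1'|i1'] := eqVneq i 1%N; first by rewrite -i1'.
  have [p _] := fo 1%N i i.+1 ltac:(lia) ltac:(lia) r.
  have := plucker (f 0%N) (f 1%N) (f i) (f i.+1).
  rewrite h01 f1 (det2_antisym (f 1%N) (f i)) (det2_antisym (f 1%N) (f i.+1)).
  have q : det2 (f 0%N) (f i) <> 0.
    move=> q; case: (parallel_primitive h01 (f1 i) q) => [e|]; last exact: no_opp.
    by move: gi1; rewrite -e f1.
  move: gi gi1 r p q.
  move: (det2 _ (f i)) (det2 _ (f i.+1)) (det2 _ (f i)) (det2 _ (f i.+1)).
  by clear => *; exfalso; nia.
have h12 := f1 1%N.
have f_n0 : f n = f 0%N by rewrite -(fn 0%N) addn0.
have hn : 0 < det2 (f 1%N) (f n.-1) /\ det2 (f n.-1) (f 0%N) = 1.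
  split; last by rewrite -f_n0 -[in f n](prednK (n := n)) ?f1 //; lia.
  have [|||i /andP[i1 ij] [gi gi1]] :=
    @sign_change (fun i => det2 (f 1%N) (f i)) 2 n.
  - lia.
  - by rewrite h12.
  - by rewrite f_n0 det2_antisym h01.
  have h20 : 0 < det2 (f 2%N) (f n) by rewrite f_n0 det2_antisym; lia.
  have q : 0 < det2 (f i) (f n).
    move: i1; rewrite leq_eqVlt => /predU1P[<- //|i1].
    by have [] := fo 2%N i n ltac:(lia) ltac:(lia) h20.
  have p : det2 (f 1%N) (f i) <> 0.
    move=> p; case: (parallel_primitive h12 (f1 i) p) => [e|]; last exact: no_opp.
    by move: gi1; rewrite -e f1.
  have [in1|in1] := eqVneq i n.-1; first by rewrite -in1; lia.
  have [s1 s2] := fo i i.+1 n ltac:(lia) ltac:(lia) q.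
  have := plucker (f 0%N) (f 1%N) (f i) (f i.+1).
  move: q s2; rewrite f_n0.
  rewrite h01 f1 (det2_antisym (f 1%N) (f i)) (det2_antisym (f 1%N) (f i.+1)).
  rewrite (det2_antisym (f 0%N) (f i)) (det2_antisym (f 0%N) (f i.+1)).
  move: gi gi1 p.
  move: (det2 _ (f i)) (det2 _ (f i.+1)) (det2 _ (f i)) (det2 _ (f i.+1)).
  by clear => *; exfalso; nia.
have h2n : 0 < det2 (f 2%N) (f n).
  by rewrite f_n0 det2_antisym; lia.
have [hh _] := fo 2%N n.-1 n ltac:(lia) ltac:(lia) h2n.
case: hn => hn1 hn0.
have := plucker (f 0%N) (f 1%N) (f 2%N) (f n.-1).
rewrite h01 (det2_antisym (f 1%N) (f 2%N)) (det2_antisym (f 1%N) (f n.-1)).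
rewrite (det2_antisym (f n.-1) (f 0%N)) hn0 h12.
move: hh hn1 h02.
move: (det2 _ (f n.-1)) (det2 _ (f n.-1)) (det2 _ (f 2%N)).
by clear => *; nia.
Qed.

Lemma periodic_mod n f i : (forall i, f (n + i)%N = f i :> ivec) ->
  f (i %% n)%N = f i.
Proof.
move=> fn; rewrite [in RHS](divn_eq i n); elim: (i %/ n)%N => [|q IH].
  by rewrite mul0n.
by rewrite mulSn -addnA fn.
Qed.

Lemma no_vertex_opposite_cone n f i k : (4 <= n)%N ->
  (forall i j, f i <> - f j) -> periodic_polygon n f ->
  ~ (0 < det2 (f i.+1) (f k) /\ 0 < det2 (f k) (f i)).
Proof.
move=> n4 no_opp hf; have [fn f1 fo] := hf.
pose h := fun j => f (i + j)%N.
have hh : periodic_polygon n h := shift_polygon i hf.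
have [hn _ _] := hh.
(* The index is [k - i] modulo [n]; [n - i %% n] is never truncated. *)
have -> : f k = h ((k + (n - i %% n)) %% n)%N.
  rewrite periodic_mod // /h.
  have -> : (i + (k + (n - i %% n)) = (i %/ n).+1 * n + k)%N.
    have : (i %% n < n)%N by rewrite ltn_mod; lia.
    rewrite mulSn; have := divn_eq i n.
    by move: (i %% n)%N (i %/ n * n)%N => r q; lia.
  by rewrite -[RHS](periodic_mod _ fn) modnMDl periodic_mod.
set j := (_ %% n)%N.
have jn : (j < n)%N by rewrite ltn_mod; lia.
have -> : f i = h 0%N by rewrite /h addn0.
have -> : f i.+1 = h 1%N by rewrite /h addn1.
have [j1|] := leqP j 1.
  have [->|->] : j = 0%N \/ j = 1%N by lia.
  - by rewrite det2vv; case.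
  - by rewrite det2vv; case.
move=> j1; apply: (@no_vertex_opposite_first_cone n h) => //.
  by move=> a b; apply: no_opp.
by rewrite j1.
Qed.

Lemma opposite_vertices n f : (4 <= n)%N -> periodic_polygon n f ->
  exists i j, f i = - f j.
Proof.
move=> n4 hf; apply: contrapT => nopp.
have no_opp i j : f i <> - f j by move=> e; apply: nopp; exists i, j.
have [fn f1 fo] := hf.
have nocone i k := @no_vertex_opposite_cone n f i k n4 no_opp hf.
have f_n0 : f n = f 0%N by rewrite -(fn 0%N) addn0.
(* The edge from [f j] to [f j.+1] crosses the ray of [- f 0]. *)
have [|||j _ [gj gj1]] := @sign_change (fun i => det2 (f 0%N) (f i)) 1 n.-1.
- lia.
- by rewrite f1.
- have := f1 n.-1; rewrite prednK; last lia.
  by rewrite f_n0 det2_antisym; lia.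
(* All [- f i] lie in the open cone of [f j] and [f j.+1]. *)
have inside i : 0 < det2 (f i) (f j) /\ 0 < det2 (f j.+1) (f i).
  elim: i => [|i [IH1 IH2]].
    split; last by rewrite det2_antisym; lia.
    rewrite lt_neqAle gj andbT; apply/eqP => /esym q.
    case: (parallel_primitive (f1 0%N) (f1 j) q) => [e|]; last exact: no_opp.
    by move: gj1; rewrite -e f1.
  have q1 : 0 < det2 (f j.+1) (f i.+1).
    rewrite ltNge; apply/negP; rewrite le_eqVlt => /predU1P[q|q].
      case: (parallel_primitive (f1 j.+1) (f1 i.+1) q) => [e|]; last exact: no_opp.
      by move: IH2; rewrite -e det2_antisym f1.
    by apply: (nocone i j.+1); rewrite det2_antisym oppr_gt0.
  split=> //.
  have := plucker (f j) (f j.+1) (f i) (f i.+1).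
  rewrite !f1 (det2_antisym (f j.+1) (f i)) (det2_antisym (f j.+1) (f i.+1)).
  rewrite (det2_antisym (f i) (f j)) (det2_antisym (f i.+1) (f j)).
  move: IH1 IH2 q1.
  move: (det2 (f i) _) (det2 _ (f i)) (det2 _ (f i.+1)) (det2 (f i.+1) _).
  by clear => *; nia.
by have [] := inside j; rewrite det2vv.
Qed.

(** * Polar angles *)

Definition has_angle (R : realType) (v : ivec) (a : R) := exists2 r : R, 0 < r &
  realvec R v = \col_(j < 2) [:: r * cos a; r * sin a]`_j.

Lemma det2_sin (R : realType) (x y : ivec) (a b : R) :
  has_angle x a -> has_angle y b ->
  exists2 r, 0 < r & (det2 x y)%:~R = r * sin (b - a).
Proof.
move=> [r r0 hx] [s s0 hy]; exists (r * s); first exact: mulr_gt0.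
have entry v t c (i : 'I_2) :
    realvec R v = \col_(j < 2) [:: t * cos c; t * sin c]`_j ->
    (v i 0)%:~R = [:: t * cos c; t * sin c]`_i.
  by move=> /matrixP/(_ i 0); rewrite !mxE.
rewrite det2E rmorphB !rmorphM /=.
rewrite (entry _ _ _ 0 hx) (entry _ _ _ 1 hx) (entry _ _ _ 0 hy) (entry _ _ _ 1 hy).
by rewrite sinB /=; ring.
Qed.

Lemma det2_gt0_angle (R : realType) (x y : ivec) (a b : R) :
  has_angle x a -> has_angle y b -> a < b < a + 2 * pi ->
  (0 < det2 x y) = (b - a < pi).
Proof.
move=> hx hy /andP[ab ba]; have [r r0 e] := det2_sin hx hy.
rewrite -(ltr0z R) e pmulr_rgt0 //; have [bpi|bpi] := ltP (b - a) pi.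
  by rewrite sin_gt0_pi // bpi subr_gt0 ab.
apply/negbTE; rewrite -leNgt -[b - a](subrK pi) sinDpi oppr_le0.
by apply: sin_ge0_pi; rewrite subr_ge0 bpi; lra.
Qed.

Lemma ccw_of_angles (R : realType) (x y z : ivec) (a b c : R) :
  has_angle x a -> has_angle y b -> has_angle z c ->
  a < b -> b < c -> c < a + 2 * pi -> ccw x y z.
Proof.
move=> hx hy hz ab bc ca; rewrite /ccw (det2_gt0_angle hx hz); last by lra.
rewrite (det2_gt0_angle hx hy); last by lra.
by rewrite (det2_gt0_angle hy hz) => [ac|]; [split|]; lra.
Qed.

(** The polar angles extend to all indices, increasing by a full turn with each
    period; the extension is still strictly increasing, so the cyclic order
    holds across the closing edge as well. *)
Lemma fundamental_periodic (R : realType) (e : seq ivec) :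
  fundamental_polygon R e ->
  periodic_polygon (size e) (fun i => e`_(i %% size e)).
Proof.
move=> [n3 [t [ht tlt tmax]] e1]; set n := size e in n3 ht tlt tmax e1 *.
have n0 : (0 < n)%N by lia.
pose T i := t (i %% n)%N + (pi *+ 2) *+ (i %/ n).
have hT i : has_angle e`_(i %% n) (T i).
  have [|r r0 er] := ht (i %% n)%N; first by rewrite ltn_mod.
  exists r => //; rewrite er /T (periodicn (@sinD2pi R)).
  by rewrite (periodicn (@cosD2pi R)).
have Tn i : T (n + i)%N = T i + 2 * pi.
  by rewrite /T modnDl divnDl // divnn n0 mulrnDr mulr1n; ring.
have Tlt : {homo T : i j / (i < j)%N >-> i < j}.
  apply: homo_ltn => [y x z|i]; first exact: lt_trans.
  have mi : (i %% n < n)%N by rewrite ltn_mod.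
  rewrite /T; have [h|h] := eqVneq (i %% n).+1 n.
    have -> : (i.+1 = (i %/ n).+1 * n)%N by rewrite {1}(divn_eq i n) mulSn; lia.
    rewrite modnMl mulnK // (mulrSr (pi *+ 2)); have := tmax _ mi.
    by set q := pi *+ 2 *+ _; rewrite mulr2n; lra.
  have lti : ((i %% n).+1 < n)%N by lia.
  have -> : (i.+1 = i %/ n * n + (i %% n).+1)%N by rewrite addnS -divn_eq.
  rewrite modnMDl divnMDl // (modn_small lti) (divn_small lti).
  by rewrite addn0 ltrD2r; apply: tlt; rewrite ltnSn.
split=> [i|i|i j k /andP[ij jk] ki].
- by rewrite modnDl.
- have -> : (i.+1 %% n = (i %% n).+1 %% n)%N by rewrite -addn1 -modnDml addn1.
  by apply: e1; rewrite ltn_mod.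
- by apply: ccw_of_angles (hT _) (hT _) (hT _) _ _ _; rewrite -?Tn; exact: Tlt.
Qed.

Definition upper_angle (R : realType) (v : ivec) : R :=
  let x : R := (v 0 0)%:~R in let y : R := (v 1 0)%:~R in
  acos (x / Num.sqrt (x ^+ 2 + y ^+ 2)).

Lemma upper_angleP (R : realType) (v : ivec) : v != 0 -> 0 <= v 1 0 ->
  has_angle v (upper_angle R v) /\ 0 <= upper_angle R v <= pi.
Proof.
move=> v0 vy; rewrite /upper_angle; set x : R := (v 0 0)%:~R.
set y : R := (v 1 0)%:~R => /=; set r := Num.sqrt _.
have y0 : 0 <= y by rewrite ler0z.
have xy0 : 0 < x ^+ 2 + y ^+ 2.
  rewrite lt_neqAle addr_ge0 ?sqr_ge0 // andbT eq_sym paddr_eq0 ?sqr_ge0 //.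
  rewrite !sqrf_eq0 !intr_eq0; apply: contra v0 => /andP[/eqP h0 /eqP h1].
  by apply/eqP/ivecP; rewrite mxE.
have r0 : 0 < r by rewrite sqrtr_gt0.
have r2 : r ^+ 2 = x ^+ 2 + y ^+ 2 by rewrite sqr_sqrtr // ltW.
have bound : -1 <= x / r <= 1.
  rewrite -ler_norml normrM normfV (gtr0_norm r0) ler_pdivrMr // mul1r.
  rewrite -(@ler_pXn2r _ 2) ?nnegrE ?normr_ge0 ?(ltW r0) // real_normK ?num_real //.
  by rewrite r2 lerDl sqr_ge0.
split; last by rewrite acos_ge0 ?acos_lepi.
exists r => //; apply/matrixP => i j; rewrite (ord1 j) !mxE.
rewrite acosK // sin_acos //.
have -> : Num.sqrt (1 - (x / r) ^+ 2) = y / r.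
  have -> : 1 - (x / r) ^+ 2 = (y / r) ^+ 2.
    rewrite !exprMn -mulNr -[1](divff (x := r ^+ 2)) ?expf_neq0 ?gt_eqF //.
    by rewrite exprVn -mulrDl r2; congr (_ / _); ring.
  by rewrite sqrtr_sqr ger0_norm // divr_ge0 // ltW.
rewrite !(mulrC r) !divfK ?gt_eqF //.
by case: i => [[|[|//]] hi] /=; congr (v _ _)%:~R; apply/val_inj.
Qed.

Lemma upper_angle_lt (R : realType) (u v : ivec) :
  u != 0 -> 0 <= u 1 0 -> v != 0 -> 0 <= v 1 0 ->
  0 < det2 u v -> upper_angle R u < upper_angle R v.
Proof.
move=> u0 uy v0 vy; have [hu /andP[u1 u2]] := upper_angleP R u0 uy.
have [hv /andP[v1 v2]] := upper_angleP R v0 vy.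
have [r r0 e] := det2_sin hu hv; rewrite -(ltr0z R) e pmulr_rgt0 // => s.
rewrite ltNge; apply/negP => vu; move: s; apply/negP.
rewrite -leNgt -opprB sinN oppr_le0.
by apply: sin_ge0_pi; lra.
Qed.

Lemma half_plane_anticlockwise (R : realType) (e : seq ivec) :
  (forall v, v \in e -> v != 0 /\ 0 <= v 1 0) ->
  sorted (fun x y => det2 x y == 1) e -> uniq e /\ anticlockwise R e.
Proof.
move=> he se.
have sa : sorted (relpre (upper_angle R) <%R) e.
  apply: (sub_in_sorted (P := [in e])) (allss e) se => u v /he[u0 uy] /he[v0 vy] /eqP uv.
  by apply: upper_angle_lt; rewrite // uv.
have tr : transitive (relpre (upper_angle R) <%R : rel ivec).
  by move=> y x z /=; exact: lt_trans.
split; first by apply: (sorted_uniq tr) sa => x /=; exact: ltxx.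
exists (fun i => upper_angle R e`_i); split=> [i hi|i j /andP[ij hj]|i hi].
- by have [v0 vy] := he _ (mem_nth 0 hi); have [] := upper_angleP R v0 vy.
- have := sorted_ltn_nth tr 0 sa; apply=> //; rewrite inE //.
  exact: ltn_trans ij hj.
- have [v0 vy] := he _ (mem_nth 0 hi).
  have [w0 wy] := he _ (mem_nth 0 (leq_ltn_trans (leq0n i) hi)).
  have [_] := upper_angleP R v0 vy; have [_] := upper_angleP R w0 wy.
  by have := pi_gt0 R; lra.
Qed.

(** * The correspondence with half-plane polygons *)

(** The last condition excludes the origin. *)
Definition second_quadrant (w : ivec) :=
  [/\ 0 <= w 1 0, w 0 0 <= 0 & w 0 0 < w 1 0].

Lemma second_quadrantD x y :
  second_quadrant x -> second_quadrant y -> second_quadrant (x + y).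
Proof.
rewrite /second_quadrant !mxE.
move: (x 0 0) (x 1 0) (y 0 0) (y 1 0) => a b c d.
by case=> ? ? ? [? ? ?]; split; lia.
Qed.

Lemma second_quadrant_upper w : second_quadrant w -> w != 0 /\ 0 <= w 1 0.
Proof.
by case=> h1 h2 h3; split=> //; apply: contraTneq h3 => ->; rewrite !mxE.
Qed.

Lemma E_half_plane (R : realType) T : half_plane_polygon R (nnodes T + 2)%N (E T).
Proof.
have hs : size (E T) = (nnodes T + 2).+1.
  by rewrite /= size_cat sizeW /= addn1 addn2.
have hdet : sorted (fun x y => det2 x y == 1) (E T).
  by rewrite /E /= cats1 W_path !det2_vec.
have hpos v : v \in E T -> v != 0 /\ 0 <= v 1 0.
  rewrite /E !inE mem_cat inE => /or4P[/eqP->|/eqP->|hv|/eqP->]; last 2 first.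
  - apply: second_quadrant_upper.
    by apply: (W_closed second_quadrantD) hv; rewrite /second_quadrant !coordE.
  - by apply: second_quadrant_upper; rewrite /second_quadrant !coordE.
  - by rewrite coordE; split=> //; apply/eqP => /matrixP/(_ 0 0); rewrite !mxE.
  - by apply: second_quadrant_upper; rewrite /second_quadrant !coordE.
have [hu ha] := half_plane_anticlockwise R hpos hdet.
split=> //; split=> //.
  split=> //; rewrite -[(_ + 2)%N]/((nnodes T + 2).+1.-1) -hs nth_last.
  by rewrite /= cats1 last_rcons.
move=> i hi; apply/eqP; have /(sortedP 0) := hdet; apply.
by rewrite hs.
Qed.

Lemma E_inj T T' : E T = E T' -> T = T'.
Proof.
rewrite /E => -[] /eqP; rewrite !cats1 eqseq_rcons => /andP[/eqP h _].
by apply: W_inj h; rewrite det2_vec.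
Qed.

Lemma anticlockwise_ccw (R : realType) (e : seq ivec) i j k :
  anticlockwise R e -> (i < j < k)%N -> (k < size e)%N ->
  ccw e`_i e`_j e`_k.
Proof.
move=> [t [ht tlt tmax]] /andP[ij jk] hk.
have hj := ltn_trans jk hk; have hi := ltn_trans ij hj.
apply: (ccw_of_angles (ht _ hi) (ht _ hj) (ht _ hk)).
- by apply: tlt; rewrite ij.
- by apply: tlt; rewrite jk.
- have := tmax _ hk; case: i ij hi => [//|i] ij hi.
  have : t 0%N < t i.+1 by apply: tlt.
  by lra.
Qed.

Lemma iota_split k : (2 <= k)%N ->
  iota 0 k.+1 = [:: 0, 1 & iota 2 (k - 1).-1 ++ [:: k]]%N.
Proof.
case: k => [|[|k]] // _.
rewrite -[iota 0 _]/[:: 0, 1 & iota 2 k.+1]%N -(addn1 k) iotaD /=.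
by rewrite addnC addn1 subn1 addn2.
Qed.

Lemma half_plane_E (R : realType) k (e : seq ivec) : (2 <= k)%N ->
  half_plane_polygon R k e -> exists2 T, nnodes T = (k - 2)%N & E T = e.
Proof.
move=> k2 [se [_ _ ha [e0 e1 ek] he]].
have he1k : det2 e`_1 e`_k = 1 by rewrite e1 ek det2_vec.
have hc : unimodular_chain (nth 0 e) 1 k.
  apply: ccw_chain => [i /andP[_ ik]|i j l i1 ijl lk|].
  - exact: he.
  - by apply: (anticlockwise_ccw ha); rewrite // se.
  - by rewrite he1k.
have [T hT] := chain_W k2 hc he1k.
exists T; first by rewrite -(sizeW T e`_1 e`_k) -hT size_map size_iota; lia.
rewrite -[RHS](mkseq_nth 0) /mkseq se iota_split //= map_cat /=.
by rewrite hT e0 e1 ek.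
Qed.

(** * Gluing two half-plane polygons *)

Lemma frame_vec u v x y : frame u v *m vec x y = x *: u + y *: v.
Proof.
have l1 : lift 0 0 = 1 :> 'I_2 by apply/val_inj.
by apply: ivecP; rewrite mxE big_ord_recl big_ord1 !frameE l1 !coordE !mxE /=; ring.
Qed.

Lemma droplast_E T :
  droplast (E T) = [:: vec 1 0, vec 0 1 & W T (vec 0 1) (vec (- 1) 0)].
Proof.
rewrite /droplast /E -!cat_cons size_cat addn1 /=.
by rewrite take_size_cat.
Qed.

Lemma rot_periodic n (f : nat -> ivec) i : (i <= n)%N ->
  (forall j, f (n + j)%N = f j) ->
  rot i [seq f j | j <- iota 0 n] = [seq f j | j <- iota i n].
Proof.
move=> i_n fn; rewrite -map_rot /rot drop_iota take_iota (minn_idPl i_n) add0n.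
have -> : iota i n = iota i (n - i) ++ iota n i.
  by rewrite -[in LHS](subnK i_n) iotaD subnKC.
rewrite !map_cat; congr (_ ++ _).
by rewrite -[n in RHS]addn0 iotaDl -map_comp; apply: eq_map => j /=; rewrite fn.
Qed.

(** Both halves go from a vertex to its opposite: [f 0, ..., f j] and
    [f j, ..., f n].  The basis [(f 0, f 1)] is mapped by minus a shear to a
    basis starting with [f j, f j.+1], because [f j = - f 0] makes the
    coordinate of [f j.+1] along [f 1] equal to -1; the coordinate along [f 0]
    is the opposite of the parameter of the shear. *)
Lemma glue_polygon n f j : periodic_polygon n f -> (0 < j < n)%N ->
  f j = - f 0%N -> exists T1 T2 m,
    [seq f i | i <- iota 0 n]
      = [seq frame (f 0%N) (f 1%N) *m v | v <- glue_trees T1 T2 m].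
Proof.
move=> [fn f1 fo] /andP[j0 jn] fj.
have f_n0 : f n = f 0%N by rewrite -(fn 0%N) addn0.
have h01 := f1 0%N.
have h1j : det2 (f 1%N) (f j) = 1 by rewrite fj det2Nr det2_antisym h01 opprK.
have hj1n : det2 (f j.+1) (f n) = 1.
  by rewrite f_n0 -[f 0%N]opprK -fj det2Nr det2_antisym f1 opprK.
have j1 : (1 < j)%N.
  by case: (ltngtP 1 j) j0 h1j => // <- _; rewrite det2vv.
have jn1 : (j.+1 < n)%N.
  by case: (ltngtP j.+1 n) jn hj1n => // -> _; rewrite det2vv.
have chain a b : (b < n + a)%N -> det2 (f a) (f b) = 1 -> unimodular_chain f a b.
  move=> ban hab; apply: ccw_chain => [i _|i l k ai ilk kb|]; rewrite ?hab //.
  by apply: fo; lia.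
have [T1 hT1] := chain_W j1 (chain 1%N j ltac:(lia) h1j) h1j.
have [T2 hT2] := chain_W jn1 (chain j.+1 n ltac:(lia) hj1n) hj1n.
pose m := - det2 (f j.+1) (f 1%N).
exists T1, T2, m; set M := frame _ _.
pose N : 'M[int]_2 := M *m (- shear m).
have NE (v : ivec) : N *m v = M *m (- (shear m *m v)).
  by rewrite /N -mulmxA mulNmx.
have M10 : M *m vec 1 0 = f 0%N by rewrite frame_vec scale1r scale0r addr0.
have M01 : M *m vec 0 1 = f 1%N by rewrite frame_vec scale1r scale0r add0r.
have MN10 : M *m vec (- 1) 0 = f j by rewrite frame_vec scaleN1r scale0r addr0 fj.
have shearE x y : shear m *m vec x y = vec (x + m * y) y.
  rewrite -[shear m]/(frame (vec 1 0) (vec m 1)) frame_vec.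
  by apply: ivecP; rewrite !mxE /=; ring.
have oppvec x y : - vec x y = vec (- x) (- y) by apply: ivecP; rewrite !mxE.
have N10 : N *m vec 1 0 = f j.
  by rewrite NE shearE oppvec mulr0 addr0 oppr0.
have NN10 : N *m vec (- 1) 0 = f n.
  by rewrite NE shearE oppvec mulr0 addr0 oppr0 opprK f_n0.
have N01 : N *m vec 0 1 = f j.+1.
  rewrite NE shearE oppvec mulr1 add0r frame_vec opprK [RHS](basis_expand _ h01).
  by congr (_ + _ *: _); rewrite -[f 0%N]opprK -fj det2Nl f1.
have -> : glue_trees T1 T2 m = [:: vec 1 0, vec 0 1 & W T1 (vec 0 1) (vec (- 1) 0)]
    ++ [seq - (shear m *m v) | v <- [:: vec 1 0, vec 0 1
         & W T2 (vec 0 1) (vec (- 1) 0)]].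
  by rewrite /glue_trees !droplast_E.
rewrite map_cat -map_comp.
have -> : n = (j + (n - j))%N by lia.
rewrite iotaD add0n map_cat; congr (_ ++ _).
  have -> : iota 0 j = [:: 0, 1 & iota 2 (j - 1).-1]%N.
    by case: (j) j1 => [|[|l]] // _; rewrite subn1.
  by rewrite /= M10 M01 -W_map M01 MN10 -hT1.
rewrite -(eq_map NE) /=.
have -> : iota j (n - j) = [:: j, j.+1 & iota j.+2 (n - j.+1).-1]%N.
  by rewrite (_ : (n - j = (n - j.+1).-1.+2)%N) //; lia.
by rewrite /= N10 N01 -W_map N01 NN10 -hT2.
Qed.

Theorem mainTheorem5 (R : realType) :
  (forall k : nat, (2 <= k)%N ->
     set_bij [set T : btree | nnodes T = (k - 2)%N]
             [set e : seq 'cV[int]_2 | half_plane_polygon R k e] E)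
  /\
  (forall e : seq 'cV[int]_2, fundamental_polygon R e -> (4 <= size e)%N ->
     exists (T1 T2 : btree) (m : int) (g : 'M[R]_2) (i : nat),
       g \in unitmx /\
       [seq g *m realvec R v | v <- e]
         = rot i [seq realvec R v | v <- glue_trees T1 T2 m]).
Proof.
split=> [k k2|e he n4].
  split=> [T /= hT|T T' _ _|e /= he].
  - by have := E_half_plane R T; rewrite hT subnK.
  - exact: E_inj.
  - by have [T hT eT] := half_plane_E k2 he; exists T.
set n := size e in n4.
have n0 : (0 < n)%N by lia.
pose f i := e`_(i %% n).
have hf : periodic_polygon n f := fundamental_periodic he.
have [fn f1 _] := hf.
have [i0 [j0 opp]] := opposite_vertices n4 hf.
(* Numbering the vertices from [f j0] on, the opposite one gets index [i0 - j0]
   modulo [n]. *)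
pose i := (j0 %% n)%N; have i_n : (i < n)%N by rewrite ltn_mod.
pose h l := f (i + l)%N; pose j := ((i0 + (n - i)) %% n)%N.
have hh : periodic_polygon n h := shift_polygon i hf.
have [hn _ _] := hh.
have h0 : h 0%N = f j0 by rewrite /h addn0 periodic_mod.
have hj : h j = - h 0%N.
  rewrite h0 -opp /j periodic_mod // /h.
  by have -> : (i + (i0 + (n - i)) = n + i0)%N; [lia|rewrite fn].
have j_n : (j < n)%N by rewrite ltn_mod.
have j_gt0 : (0 < j)%N.
  rewrite lt0n; apply/eqP => j0'; move: hj; rewrite j0' => h0N.
  have [_ h1 _] := hh; have := h1 0%N.
  have -> : h 0%N = 0.
    by apply: ivecP; have := congr1 (fun v : ivec => (v 0 0, v 1 0)) h0N;
      rewrite !mxE => -[? ?]; lia.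
  by rewrite det2E !mxE !mul0r subr0.
have j_in : (0 < j < n)%N by rewrite j_gt0.
have [T1 [T2 [m glue]]] := glue_polygon hh j_in hj.
move: glue; set M := frame _ _; set G := glue_trees _ _ _ => glue.
have detM : \det M = 1 by have [_ h1 _] := hh; exact: (h1 0%N).
pose MR := map_mx (intr : int -> R) M.
have MRu : MR \in unitmx by rewrite unitmxE det_map_mx detM rmorph1 unitr1.
exists T1, T2, m, (invmx MR), (size G - i)%N; rewrite unitmx_inv; split=> //.
have eG : e = rot (size G - i) [seq M *m v | v <- G].
  have -> : rot (size G - i) [seq M *m v | v <- G] = rotr i [seq M *m v | v <- G].
    by rewrite /rotr size_map.
  apply: (canRL (rotK i)); rewrite -glue.
  have -> : e = [seq f l | l <- iota 0 n].
    rewrite -[LHS](mkseq_nth 0); apply/eq_in_map => l.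
    by rewrite mem_iota add0n /f => /andP[_ ln]; rewrite modn_small.
  rewrite rot_periodic ?(ltnW i_n) // /h -[i in iota i n]addn0 iotaDl.
  by rewrite -map_comp.
rewrite [in LHS]eG !map_rot -map_comp; congr rot; apply: eq_map => v /=.
by rewrite /realvec map_mxM mulKmx.
Qed.
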